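(* Let $t_0\in\mathbb{R}$, let $A,\Delta,K:[t_0,\infty)\to\mathbb{R}^{n\times n}$ be piecewise continuous, $B\in\mathbb{R}^{n\times n}$ constant, and $\omega:\mathbb{R}^n\times[t_0,\infty)\to\mathbb{R}^n$ piecewise continuous (no assumption $\omega(0,t)=0$ is made). Consider \[ \dot x=\big[A(t)+\Delta(t)\big]x+BK(t)x+\omega(x,t),\qquad t\ge t_0 . \] Suppose that for some vector norm $\|\cdot\|$ on $\mathbb{R}^n$ with associated logarithmic norm $\mu$: (A1) $\int_{t_0}^\infty|\mu[\Delta(s)]|\,ds<\infty$; (A2) there is $T\ge t_0$ such that $\mu[A(t)+BK(t)]<0$ for all $t\ge T$; (A3) there is a piecewise continuous function $\tilde\omega:[t_0,\infty)\to\mathbb{R}^n$ with $\|\omega(x,t)\|\le\|\tilde\omega(t)\|$ for all $x\in\mathbb{R}^n$, $t\ge t_0$, and \[ \lim_{t\to\infty}\frac{\|\tilde\omega(t)\|}{\mu[A(t)+BK(t)]}=0; \] (A4) $\int_{t_0}^t\mu[A(s)+BK(s)]\,ds\to-\infty$ as $t\to\infty$. Then every solution $x:[t_0,\infty)\to\mathbb{R}^n$ of this system satisfies $x(t)\to0$ as $t\to\infty$.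
   Context: For a vector norm $\|\cdot\|$ on $\mathbb{R}^n$, matrices are normed by the induced operator norm $\|\mathcal{A}\|=\max_{\|x\|=1}\|\mathcal{A}x\|$. The logarithmic norm of $\mathcal{A}\in\mathbb{R}^{n\times n}$ is $\mu[\mathcal{A}]=\lim_{h\to0^+}\frac{\|I_n+h\mathcal{A}\|-1}{h}$, where $I_n$ is the identity matrix; it can be negative. *)

(* Defs.v *)
From HB Require Import structures.
From mathcomp Require Import all_boot all_order all_algebra.
From mathcomp Require Import all_classical all_reals all_analysis.
Set Implicit Arguments. Unset Strict Implicit. Unset Printing Implicit Defensive.
Import Order.TTheory GRing.Theory Num.Theory.
Import numFieldNormedType.Exports.
Local Open Scope classical_set_scope.
Local Open Scope ring_scope.

Definition is_vnorm (R : realType) (n : nat) (N : 'cV[R]_n -> R) : Prop :=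
  [/\ (forall x, 0 <= N x),
      (forall x, N x = 0 -> x = 0),
      (forall (a : R) x, N (a *: x) = `|a| * N x) &
      (forall x y, N (x + y) <= N x + N y)].

Definition opnorm (R : realType) (n : nat) (N : 'cV[R]_n -> R) (A : 'M[R]_n) : R :=
  sup [set N (A *m x) | x in [set x | N x = 1]].

Definition lognorm (R : realType) (n : nat) (N : 'cV[R]_n -> R) (A : 'M[R]_n) : R :=
  lim ((opnorm N (1%:M + h *: A) - 1) / h @[h --> 0^'+]).

Definition pw_continuous (R : realType) (V : normedModType R) (t0 : R) (f : R -> V) : Prop :=
  forall b, t0 < b -> exists D : seq R,
    [/\ (forall t, t0 < t < b -> t \notin D -> f @ t --> f t),
        (forall t, t0 <= t < b -> exists l : V, f s @[s --> t^'+] --> l) &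
        (forall t, t0 < t <= b -> exists l : V, f s @[s --> t^'-] --> l)].

Definition pw_continuous2 (R : realType) (n : nat) (t0 : R)
    (w : 'cV[R]_n -> R -> 'cV[R]_n) : Prop :=
  forall b, t0 < b -> exists D : seq R,
    [/\ (forall (x : 'cV[R]_n) t, t0 < t < b -> t \notin D ->
           (fun p : 'cV[R]_n * R => w p.1 p.2) @ (x, t) --> w x t),
        (forall (x : 'cV[R]_n) t, t0 <= t < b -> exists l : 'cV[R]_n,
           (fun p : 'cV[R]_n * R => w p.1 p.2)
             @ within [set p : 'cV[R]_n * R | t < p.2] (nbhs (x, t)) --> l) &
        (forall (x : 'cV[R]_n) t, t0 < t <= b -> exists l : 'cV[R]_n,
           (fun p : 'cV[R]_n * R => w p.1 p.2)
             @ within [set p : 'cV[R]_n * R | p.2 < t] (nbhs (x, t)) --> l)].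

Definition is_solution (R : realType) (n : nat) (t0 : R)
    (F : 'cV[R]_n -> R -> 'cV[R]_n) (x : R -> 'cV[R]_n) : Prop :=
  {within `[t0, +oo[, continuous x} /\
  forall b, t0 < b -> exists D : seq R,
    forall t, t0 < t < b -> t \notin D -> is_derive t 1 x (F (x t) t).

(* Main.v *)
(* Put v = N (x t), lam = lognorm (A + B K), del = |lognorm Delta|. Since
   N (x + h M x) <= opnorm (1 + h M) N x, the upper right Dini derivative of v is
   at most (lam + del) v + N (wt t), by subadditivity of the logarithmic norm. Once
   N (wt t) <= - eps lam, the function (v exp (- int del) - eps) exp (- int lam) has
   nonpositive Dini derivative off a locally finite set, hence is nonincreasing, so
   v exp (- int del) <= eps + const * exp (int lam). As int del is bounded and
   int lam tends to -oo, limsup v <= eps exp (int del) for every eps. *)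
Require Import Defs.
From HB Require Import structures.
From mathcomp Require Import all_boot all_order all_algebra.
From mathcomp Require Import all_classical all_reals all_analysis.
From mathcomp Require Import measurable_realfun ring lra.
Import Order.TTheory GRing.Theory Num.Theory.
Import numFieldNormedType.Exports.
Local Open Scope classical_set_scope.
Local Open Scope ring_scope.

Set Implicit Arguments.
Unset Strict Implicit.

(** * The entrywise maximum norm of matrices *)

Section MatrixNorm.
Context {R : realType}.

Lemma mx_entry_le_norm m n (M : 'M[R]_(m, n)) i j : `|M i j| <= `|M|.
Proof.
by rewrite [leRHS]/Num.norm /= mx_normrE; apply: (le_bigmax _ _ (i, j)).
Qed.

Lemma mx_norm_le m n (M : 'M[R]_(m, n)) (r : R) : 0 <= r ->
  (forall i j, `|M i j| <= r) -> `|M| <= r.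
Proof.
move=> r0 Mr; rewrite [leLHS]/Num.norm /= mx_normrE.
by apply: bigmax_le => // -[i j] _ /=.
Qed.

Lemma norm_trmx m n (M : 'M[R]_(m, n)) : `|M^T| = `|M|.
Proof.
apply/le_anti/andP; split; apply: mx_norm_le => // i j.
  by rewrite mxE mx_entry_le_norm.
by rewrite -[M]trmxK mxE trmxK mx_entry_le_norm.
Qed.

Lemma norm_mulmx_le m n p (M : 'M[R]_(m, n)) (P : 'M[R]_(n, p)) :
  `|M *m P| <= n%:R * `|M| * `|P|.
Proof.
apply: mx_norm_le => [|i k]; first by rewrite !mulr_ge0.
rewrite mxE (le_trans (ler_norm_sum _ _ _))//.
rewrite (le_trans (ler_sum _ (G := fun=> `|M| * `|P|) _))//.
  by move=> j _; rewrite normrM ler_pM// mx_entry_le_norm.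
by rewrite sumr_const card_ord -mulrA mulr_natl.
Qed.

Lemma dist_le_continuous {V W : normedModType R} (f : V -> W) (C : R) :
  (forall x y, `|f x - f y| <= C * `|x - y|) -> continuous f.
Proof.
move=> fC x; apply/cvgrPdist_le => /= e e0; near=> y.
(* The sign of [C] is unknown, so [|C| + 1] replaces it as a positive Lipschitz constant. *)
rewrite (le_trans (fC _ _))// (@le_trans _ _ ((`|C| + 1) * `|x - y|))//.
  by rewrite ler_wpM2r// (le_trans (ler_norm C))// lerDl.
have C1 : 0 < `|C| + 1 by rewrite ltr_wpDl.
rewrite mulrC -ler_pdivlMr//.
by near: y; apply: cvgr_dist_le => //; rewrite divr_gt0.
Unshelve. all: by end_near. Qed.

Lemma mulmx_continuous m n p (B : 'M[R]_(m, n)) :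
  continuous (fun M : 'M[R]_(n, p) => B *m M).
Proof.
apply: (@dist_le_continuous _ _ _ (n%:R * `|B|)) => M P.
by rewrite -mulmxBr norm_mulmx_le.
Qed.

End MatrixNorm.

(** * Equivalence of an arbitrary vector norm with the maximum norm *)

Section VectorNorm.
Context {R : realType} {n : nat} {N : 'cV[R]_n -> R} (vN : is_vnorm N).
Implicit Types (x y : 'cV[R]_n) (M : 'M[R]_n).

Lemma vnorm_ge0 x : 0 <= N x. Proof. by case: vN. Qed.

Lemma vnormZ (a : R) x : N (a *: x) = `|a| * N x. Proof. by case: vN. Qed.

Lemma vnormD x y : N (x + y) <= N x + N y. Proof. by case: vN. Qed.

Lemma vnorm0 : N 0 = 0.
Proof. by rewrite -(scale0r 0) vnormZ normr0 mul0r. Qed.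

Lemma vnorm_eq0 x : N x = 0 -> x = 0. Proof. by case: vN => _ + _ _; exact. Qed.

Lemma vnormN x : N (- x) = N x.
Proof. by rewrite -scaleN1r vnormZ normrN1 mul1r. Qed.

Lemma vnorm_dist x y : `|N x - N y| <= N (x - y).
Proof.
rewrite ler_norml; apply/andP; split.
  rewrite lerNl opprB lerBlDr -(vnormN (x - y)) opprB.
  by rewrite -{1}(subrK x y) vnormD.
by rewrite lerBlDr -{1}(subrK y x) vnormD.
Qed.

Lemma vnorm_sum (I : Type) (r : seq I) (F : I -> 'cV[R]_n) :
  N (\sum_(i <- r) F i) <= \sum_(i <- r) N (F i).
Proof.
elim/big_ind2 : _ => //; first by rewrite vnorm0.
by move=> x a y b xa yb; rewrite (le_trans (vnormD _ _))// lerD.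
Qed.

Lemma vnorm_le_norm : exists2 C, 0 <= C & forall x, N x <= C * `|x|.
Proof.
exists (\sum_i N (delta_mx i 0)).
  by apply: sumr_ge0 => i _; exact: vnorm_ge0.
move=> x; rewrite {1}(matrix_sum_delta x) (le_trans (vnorm_sum _ _))//.
rewrite mulr_suml ler_sum// => i _.
by rewrite big_ord1 vnormZ mulrC ler_wpM2l ?vnorm_ge0// mx_entry_le_norm.
Qed.

Lemma vnorm_continuous : continuous N.
Proof.
have [C C0 NC] := vnorm_le_norm.
apply: (@dist_le_continuous R _ R^o _ C) => x y.
exact: le_trans (vnorm_dist _ _) (NC _).
Qed.

(** The unit sphere [S] of the maximum norm is compact, so the continuous function [N] has a
    positive minimum on it; [C] is the inverse of that minimum, and homogeneity extends the bound to
    all [x]. Transposes pass to row vectors, the form in which compactness and the extreme value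
    theorem are stated. *)
Lemma norm_le_vnorm : exists2 C, 0 < C & forall x, `|x| <= C * N x.
Proof.
pose S := [set v : 'rV[R]_n | `|v| = 1].
have tr_cont : continuous (fun v : 'rV[R]_n => v^T).
  apply: (@dist_le_continuous _ _ _ _ 1) => u v.
  by rewrite mul1r -linearB norm_trmx.
(* The sphere is empty only when every vector is 0; any positive constant then works. *)
have [/eqP S0|/set0P S0] := eqVneq S set0.
  exists 1 => // x; suff -> : x = 0 by rewrite normr0 mul1r vnorm_ge0.
  apply/eqP; rewrite -normr_eq0; apply/eqP; apply: contrapT => /eqP x0.
  have : S (`|x|^-1 *: x^T).
    by rewrite /S/= normrZ norm_trmx ger0_norm ?invr_ge0// mulVf.
  by move/eqP : S0 => ->.
have cS : compact S.
  apply: bounded_closed_compact.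
    by exists 1; split => // M M1 v /= ->; exact: ltW.
  have -> : S = (fun v : 'rV[R]_n => `|v|) @^-1` [set r : R | r = 1] by [].
  by apply: preimage_closed => [v _|]; [exact: norm_continuous|exact: closed_eq].
have [|v Sv vmin] := @EVT_min_rV R n (fun v => N v^T) S S0 cS.
  apply: continuous_subspaceT => v.
  by apply: continuous_comp; [exact: tr_cont|exact: vnorm_continuous].
have Nv : 0 < N v^T.
  rewrite lt_def vnorm_ge0 andbT; apply/eqP => /vnorm_eq0 v0.
  by move: (set_mem Sv); rewrite /S/= -norm_trmx v0 normr0 => /eqP; rewrite eq_sym oner_eq0.
exists (N v^T)^-1; first by rewrite invr_gt0.
move=> x; have [->|x0] := eqVneq x 0.
  by rewrite normr0 vnorm0 mulr0.
rewrite ler_pdivlMl// mulrC.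
have /vmin : (`|x|^-1 *: x^T) \in S.
  by apply: mem_set; rewrite /S/= normrZ norm_trmx ger0_norm ?invr_ge0// mulVf// normr_eq0.
by rewrite linearZ/= trmxK vnormZ ger0_norm ?invr_ge0// ler_pdivlMl// normr_gt0.
Qed.

End VectorNorm.

(** * The induced operator norm *)

Section OperatorNorm.
Context {R : realType} {n : nat} {N : 'cV[R]_n -> R} (vN : is_vnorm N).
Implicit Types (x y : 'cV[R]_n) (M P : 'M[R]_n).

Lemma vnorm_mulmx_le :
  exists2 C, 0 <= C & forall M x, N (M *m x) <= C * `|M| * N x.
Proof.
have [C1 C1_ge0 NC1] := vnorm_le_norm vN.
have [C2 C2_gt0 NC2] := norm_le_vnorm vN.
exists (C1 * n%:R * C2) => [|M x]; first by rewrite !mulr_ge0// ltW.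
rewrite (le_trans (NC1 _))//.
rewrite (le_trans (ler_wpM2l C1_ge0 (norm_mulmx_le _ _)))//.
rewrite [leRHS](_ : _ = C1 * (n%:R * `|M| * (C2 * N x))); last by ring.
by rewrite ler_wpM2l// ler_wpM2l// mulr_ge0.
Qed.

(** The supremum is a true upper bound because equivalence of norms bounds the set of values on the
    unit sphere of [N]; scaling [x] to that sphere does the rest. *)
Lemma opnorm_ub M x : N (M *m x) <= opnorm N M * N x.
Proof.
have [C C0 NC] := vnorm_mulmx_le.
have [->|x0] := eqVneq x 0; first by rewrite mulmx0 vnorm0// mulr0.
have Nx : 0 < N x.
  by rewrite lt_def vnorm_ge0// andbT; apply: contra_neq x0; exact: vnorm_eq0.
rewrite -ler_pdivrMr//; apply: ub_le_sup.
  by exists (C * `|M|) => _ [y /= y1 <-]; rewrite (le_trans (NC _ _))// y1 mulr1.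
exists ((N x)^-1 *: x) => /=.
  by rewrite vnormZ// ger0_norm ?invr_ge0 ?vnorm_ge0// mulVf// gt_eqF.
by rewrite -scalemxAr vnormZ// ger0_norm ?invr_ge0 ?vnorm_ge0// mulrC.
Qed.

Lemma opnorm_le M (r : R) : 0 <= r ->
  (forall x, N (M *m x) <= r * N x) -> opnorm N M <= r.
Proof.
move=> r0 Mr; rewrite /opnorm; set S := (X in sup X).
(* In dimension 0 the set is empty and its [sup] is 0 by convention, whence the assumption
   [0 <= r]. *)
have [->|/set0P S0] := eqVneq S set0; first by rewrite sup0.
by apply: ge_sup => // _ [x /= x1 <-]; rewrite (le_trans (Mr _))// x1 mulr1.
Qed.

Lemma opnorm_ge0 M : 0 <= opnorm N M.
Proof.
rewrite /opnorm; set S := (X in sup X).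
have [->|/set0P[_ [x /= x1 _]]] := eqVneq S set0; first by rewrite sup0.
have := opnorm_ub M x; rewrite x1 mulr1; apply: le_trans.
exact: vnorm_ge0.
Qed.

Lemma opnormD M P : opnorm N (M + P) <= opnorm N M + opnorm N P.
Proof.
apply: opnorm_le => [|x]; first by rewrite addr_ge0// opnorm_ge0.
by rewrite mulmxDl (le_trans (vnormD vN _ _))// mulrDl lerD// opnorm_ub.
Qed.

Lemma opnormZ (a : R) M : opnorm N (a *: M) <= `|a| * opnorm N M.
Proof.
apply: opnorm_le => [|x]; first by rewrite mulr_ge0// opnorm_ge0.
by rewrite -scalemxAl vnormZ// -mulrA ler_wpM2l// opnorm_ub.
Qed.

Lemma opnorm_le_norm : exists2 C, 0 <= C & forall M, opnorm N M <= C * `|M|.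
Proof.
have [C C0 NC] := vnorm_mulmx_le.
by exists C => // M; apply: opnorm_le => //; rewrite mulr_ge0.
Qed.

End OperatorNorm.

Lemma opnorm1 {R : realType} n (N : 'cV[R]_n.+1 -> R) :
  is_vnorm N -> opnorm N 1%:M = 1.
Proof.
move=> vN; apply/le_anti/andP; split.
  by apply: opnorm_le => // x; rewrite mul1mx mul1r.
have := opnorm_ub vN 1%:M (const_mx 1).
rewrite mul1mx ler_pMl// lt_def vnorm_ge0// andbT.
apply/eqP => /(vnorm_eq0 vN)/matrixP/(_ 0 0).
by rewrite !mxE => /eqP; rewrite oner_eq0.
Qed.

(** * Existence, subadditivity and continuity of the logarithmic norm *)

Section LogarithmicNorm.
(* For n = 0 the operator norm of the identity is 0 and the limit defining the
   logarithmic norm does not exist. *)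
Context {R : realType} {n : nat} {N : 'cV[R]_n.+1 -> R} (vN : is_vnorm N).
Implicit Types (x y : 'cV[R]_n.+1) (M P : 'M[R]_n.+1).

Let q M (h : R) := (opnorm N (1%:M + h *: M) - 1) / h.

(** Convexity: [1 + h M] is the convex combination of [1] and [1 + k M] with weights [(k - h) / k]
    and [h / k], and the identity has operator norm 1. *)
Let q_mono M h k : 0 < h -> h <= k -> q M h <= q M k.
Proof.
move=> h0 hk; have k0 : 0 < k by exact: lt_le_trans hk.
rewrite /q ler_pdivrMr// mulrAC ler_pdivlMr//.
have E : k *: (1%:M + h *: M) = (k - h) *: 1%:M + h *: (1%:M + k *: M).
  rewrite !scalerDr addrA -scalerDl subrK; congr (_ + _).
  by rewrite !scalerA mulrC.
have E2 : 1%:M + h *: M = k^-1 *: ((k - h) *: 1%:M + h *: (1%:M + k *: M)).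
  by rewrite -E scalerA mulVf ?scale1r// gt_eqF.
rewrite mulrC.
suff : k * opnorm N (1%:M + h *: M) <= (k - h) + h * opnorm N (1%:M + k *: M).
  by move=> ?; lra.
rewrite {1}E2 -ler_pdivlMl// (le_trans (opnormZ vN _ _))//.
rewrite ger0_norm ?invr_ge0 ?(ltW k0)// ler_wpM2l ?invr_ge0 ?(ltW k0)//.
rewrite (le_trans (opnormD vN _ _))// lerD//.
  by rewrite (le_trans (opnormZ vN _ _))// opnorm1// mulr1 ger0_norm// subr_ge0.
by rewrite (le_trans (opnormZ vN _ _))// gtr0_norm.
Qed.

Let q_lb M h : 0 < h -> - opnorm N M <= q M h.
Proof.
move=> h0; rewrite /q ler_pdivlMr//.
have : opnorm N 1%:M <= opnorm N (1%:M + h *: M) + h * opnorm N M.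
  have {1}-> : 1%:M = (1%:M + h *: M) + (- h) *: M by rewrite scaleNr addrK.
  rewrite (le_trans (opnormD vN _ _))// lerD2l (le_trans (opnormZ vN _ _))//.
  by rewrite normrN gtr0_norm.
by rewrite opnorm1// => ?; lra.
Qed.

Let q_ub M h : 0 < h -> q M h <= opnorm N M.
Proof.
move=> h0; rewrite /q ler_pdivrMr// mulrC.
have := opnormD vN 1%:M (h *: M); have := opnormZ vN h M.
by rewrite opnorm1// gtr0_norm// => *; lra.
Qed.

(** The difference quotient is nondecreasing in [h] and bounded below by [- opnorm N M], so its
    right limit at 0 exists and the [lim] in [lognorm] is a genuine limit. *)
Lemma lognorm_cvg M :
  (opnorm N (1%:M + h *: M) - 1) / h @[h --> 0^'+] --> lognorm N M.
Proof.
apply: (@nondecreasing_at_right_is_cvgr _ (q M) 0).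
  near=> x; move=> h k; rewrite in_itv/= => /andP[h0 hx] kx hk.
  exact: q_mono.
near=> x; exists (- opnorm N M) => r [h /=]; rewrite in_itv/= => /andP[h0 hx] <-.
exact: q_lb.
Unshelve. all: by end_near. Qed.

Lemma lognorm_le_opnorm M : lognorm N M <= opnorm N M.
Proof.
apply: (cvgr_to_le (lognorm_cvg (M := M))).
by near=> h; apply: q_ub.
Unshelve. all: by end_near. Qed.

(** [1 + h (M + P)] is the average of [1 + 2h M] and [1 + 2h P], so the quotient of [M + P] at [h]
    is at most the sum of the quotients of [M] and [P] at [2h]. *)
Lemma lognormD M P : lognorm N (M + P) <= lognorm N M + lognorm N P.
Proof.
have dbl : (fun h : R => 2 * h) @ 0^'+ --> (0 : R)^'+.
  move=> A [e /= e0 eA]; exists (e / 2); first by rewrite /= divr_gt0.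
  move=> h /=; rewrite sub0r normrN => he h0; apply: eA; last by rewrite mulr_gt0.
  by rewrite /= sub0r normrN normrM ger0_norm// mulrC -ltr_pdivlMr.
apply: (ler_cvg_to (lognorm_cvg (M := M + P)) (cvgD
  (cvg_comp _ _ dbl (lognorm_cvg (M := M))) (cvg_comp _ _ dbl (lognorm_cvg (M := P))))).
near=> h; rewrite /= !fctE.
have h0 : 0 < h by [].
rewrite -mulrDl ler_pdivrMr// mulrAC ler_pdivlMr ?mulr_gt0//.
suff : 2 * opnorm N (1%:M + h *: (M + P)) <=
    opnorm N (1%:M + (2 * h) *: M) + opnorm N (1%:M + (2 * h) *: P).
  by move=> /(ler_wpM2r (ltW h0)) ?; lra.
have -> : 1%:M + h *: (M + P) = 2^-1 *: ((1%:M + (2 * h) *: M) + (1%:M + (2 * h) *: P)).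
  apply/matrixP => i j; by rewrite !mxE; field.
rewrite (le_trans (ler_wpM2l _ (opnormZ vN _ _)))//.
by rewrite ger0_norm// mulrA mulfV// mul1r opnormD.
Unshelve. all: by end_near. Qed.

(** Subadditivity bounds the difference of two values by [lognorm N (M - P)], hence by a multiple of
    the norm of [M - P]: the function is Lipschitz. *)
Lemma lognorm_continuous : continuous (lognorm N).
Proof.
have [C C0 NC] := opnorm_le_norm vN.
apply: (@dist_le_continuous R _ R^o _ C) => M P.
have H (M' P' : 'M[R]_n.+1) : lognorm N M' - lognorm N P' <= C * `|M' - P'|.
  rewrite lerBlDr -{1}(subrK P' M') (le_trans (lognormD _ _))// lerD2r.
  exact: le_trans (lognorm_le_opnorm _) (NC _).
by rewrite ler_norml H andbT lerNl opprB distrC H.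
Qed.

End LogarithmicNorm.

(** * Stability and local boundedness of piecewise continuous functions *)

Section PiecewiseContinuity.
Context {R : realType}.

Lemma pw_continuous_comp {V W : normedModType R} (t0 : R) (f : R -> V) (g : V -> W) :
  continuous g -> pw_continuous t0 f -> pw_continuous (t0 : R) (fun t => g (f t)).
Proof.
move=> gc fc b t0b; have [D [Dc Dr Dl]] := fc _ t0b.
exists D; split.
- by move=> t tb tD; apply: cvg_comp; [exact: Dc|exact: gc].
- move=> t /Dr[l fl]; exists (g l).
  by apply: cvg_comp; [exact: fl|exact: gc].
- move=> t /Dl[l fl]; exists (g l).
  by apply: cvg_comp; [exact: fl|exact: gc].
Qed.

Lemma pw_continuousD {V : normedModType R} (t0 : R) (f g : R -> V) :
  pw_continuous t0 f -> pw_continuous t0 g ->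
  pw_continuous (t0 : R) (fun t => f t + g t).
Proof.
move=> fc gc b t0b.
have [D [Dc Dr Dl]] := fc _ t0b; have [E [Ec Er El]] := gc _ t0b.
exists (D ++ E); split.
- move=> t tb; rewrite mem_cat negb_or => /andP[tD tE].
  by apply: cvgD; [exact: Dc|exact: Ec].
- move=> t tb; have [l fl] := Dr _ tb; have [k gk] := Er _ tb.
  by exists (l + k); exact: cvgD.
- move=> t tb; have [l fl] := Dl _ tb; have [k gk] := El _ tb.
  by exists (l + k); exact: cvgD.
Qed.

(** One-sided limits bound [f] on each side of every point, and the value at the point itself is one
    more bound; compactness of the segment makes the bound uniform. *)
Lemma pw_continuous_bounded (t0 b : R) (f : R -> R) : t0 < b -> pw_continuous t0 f ->
  exists M, forall t, t0 <= t <= b -> `|f t| <= M.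
Proof.
move=> t0b /(_ _ t0b)[D [_ Dr Dl]].
have cvg_bnd (F : set_system R) (l : R) : Filter F -> f @ F --> l ->
    \forall s \near F, `|f s| <= `|l| + 1.
  move=> FF fl; near=> s.
  have : `|l - f s| <= 1 by near: s; apply: cvgr_dist_le.
  by rewrite distrC => ?; rewrite -lerBlDl (le_trans (lerB_dist _ _)).
have loc (t : R) : t0 <= t <= b ->
    \forall s \near t & M \near +oo, t0 <= s <= b -> `|f s| <= M.
  move=> /andP[t0t tb].
  have [M1 M1P] : exists M1, \forall s \near t, t < s -> s <= b -> `|f s| <= M1.
    have [tb'|bt] := ltP t b.
      have [l fl] := Dr t (introT andP (conj t0t tb')).
      have fl1 : \forall s \near t, t < s -> `|f s| <= `|l| + 1 := cvg_bnd _ _ _ fl.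
      by exists (`|l| + 1); near=> s; move=> ts _; move: ts; near: s; exact: fl1.
    (* At the right end of the segment no point remains on this side, so any bound does. *)
    by exists 0; near=> s; move=> ts sb; have := lt_le_trans ts (le_trans sb bt); rewrite ltxx.
  have [M2 M2P] : exists M2, \forall s \near t, s < t -> t0 <= s -> `|f s| <= M2.
    have [t0t'|tt0] := ltP t0 t.
      have [l fl] := Dl t (introT andP (conj t0t' tb)).
      have fl1 : \forall s \near t, s < t -> `|f s| <= `|l| + 1 := cvg_bnd _ _ _ fl.
      by exists (`|l| + 1); near=> s; move=> ts _; move: ts; near: s; exact: fl1.
    by exists 0; near=> s; move=> st t0s; have := lt_le_trans st (le_trans tt0 t0s); rewrite ltxx.
  near=> s M => /= /andP[t0s sb].
  have M1M : M1 <= M by near: M; apply: nbhs_pinfty_ge; rewrite num_real.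
  have M2M : M2 <= M by near: M; apply: nbhs_pinfty_ge; rewrite num_real.
  have ftM : `|f t| <= M by near: M; apply: nbhs_pinfty_ge; rewrite num_real.
  have [st|ts|->//] := ltgtP s t.
    by rewrite (le_trans _ M2M)//; move: st t0s; near: s.
  by rewrite (le_trans _ M1M)//; move: ts sb; near: s.
have := (@compact_near_coveringP R `[t0, b]%classic).1 (@segment_compact R t0 b) R
  (+oo) (fun M t => t0 <= t <= b -> `|f t| <= M) _.
case; first by move=> t /=; rewrite in_itv/=; exact: loc.
move=> M [_ /(_ (M + 1))]; rewrite ltrDl ltr01 => /(_ isT) MP.
by exists (M + 1) => t tb; apply: MP => //=; rewrite in_itv.
Unshelve. all: by end_near. Qed.

End PiecewiseContinuity.

(** * Measurability, integrability and primitives of piecewise continuous functions *)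

Section PiecewiseIntegral.
Context {R : realType}.
Notation mu := (@lebesgue_measure R).

(** The segment is covered by the open set [U], where [f] is continuous, and a finite set [F]
    containing both endpoints, all of whose subsets are measurable. *)
Lemma pw_continuous_measurable (t0 b : R) (f : R -> R) : t0 < b ->
  pw_continuous t0 f -> measurable_fun `[t0, b] f.
Proof.
move=> t0b /(_ _ t0b)[D [Dc _ _]].
pose U := `]t0, b[%classic `&` ~` [set` D].
have oU : open U.
  apply: openI; first exact: interval_open.
  apply: closed_openC; apply: (accessible_finite_set_closed.1 _ [set` D]).
    by apply: hausdorff_accessible; exact: Rhausdorff.
  exact: finite_seq.
pose F := [set` t0 :: b :: D].
have finF : finite_set F by exact: finite_seq.
have mfin (G : set R) : G `<=` F -> measurable G.
  move=> GF; apply: countable_measurable; first exact: measurable_set1.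
  by apply: finite_set_countable; exact: sub_finite_set finF.
have mU : measurable U by exact: open_measurable.
apply: (@measurable_funS _ _ _ _ (U `|` F)).
- by apply: measurableU => //; exact: mfin.
- move=> t /=; rewrite in_itv/= => /andP[t0t tb].
  have [tD|tD] := boolP (t \in D).
    by right; rewrite /F/= !inE tD !orbT.
  have [<-|t0t'] := eqVneq t0 t; first by right; rewrite /F/= !inE eqxx.
  have [->|tb'] := eqVneq t b; first by right; rewrite /F/= !inE eqxx orbT.
  left; split; last by move=> /=; apply/negP.
  by rewrite /= in_itv/= !lt_neqAle t0t tb t0t' tb'.
apply/measurable_funU => //; first exact: mfin.
split; last by move=> _ Y mY; apply: mfin => t [].
apply: open_continuous_measurable_fun => // t.
rewrite inE /U/= in_itv/= => -[tb /negP tD]; exact: Dc.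
Qed.

Lemma pw_continuous_measurable_pinfty (t0 : R) (f : R -> R) :
  pw_continuous t0 f -> measurable_fun `[t0, +oo[ f.
Proof.
move=> fc; rewrite itv_bndy_bigcup_BRight.
apply/measurable_fun_bigcup => // k.
have [->|k0] := eqVneq k 0%N; first by rewrite addr0 set_itv1; exact: measurable_fun_set1.
apply: pw_continuous_measurable => //.
by rewrite ltrDl ltr0n lt0n.
Qed.

Lemma pw_continuous_integrable (t0 b : R) (f : R -> R) : t0 < b ->
  pw_continuous t0 f -> mu.-integrable `[t0, b] (EFin \o f).
Proof.
move=> t0b fc; apply: measurable_bounded_integrable => //.
- by apply: compact_finite_measure; exact: segment_compact.
- exact: pw_continuous_measurable.
have [M fM] := pw_continuous_bounded t0b fc.
exists M; split; first exact: num_real.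
by move=> r Mr t /= ; rewrite in_itv/= => tb; rewrite (le_trans (fM _ tb))// ltW.
Qed.

Lemma integral_is_derive (t0 b t : R) (f : R -> R) :
  pw_continuous t0 f -> t0 < t -> f @ t --> f t ->
  is_derive t 1 (fun u => \int[mu]_(s in `[t0, u]) f s) (f t).
Proof.
move=> fc t0t ft.
have tt1 : t < t + 1 by rewrite ltrDl.
have [dF F'] := continuous_FTC1_closed tt1
  (pw_continuous_integrable (lt_trans t0t tt1) fc) t0t ft.
by apply: DeriveDef => //; rewrite -derive1E.
Qed.

Lemma integral_continuous (t0 b : R) (f : R -> R) : t0 < b ->
  pw_continuous t0 f ->
  {within `[t0, b], continuous (fun u => \int[mu]_(s in `[t0, u]) f s)}.
Proof.
move=> t0b fc; apply: parameterized_integral_continuous; first exact: ltW.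
exact: pw_continuous_integrable.
Qed.

End PiecewiseIntegral.

(** * Upper right Dini derivatives and monotonicity *)

Section DiniDerivative.
Context {R : realType}.
Implicit Types (v e : R -> R) (t L : R).

(* The upper right Dini derivative of v at t is at most L. *)
Definition dini_le v t L :=
  forall eps, 0 < eps -> \forall h \near 0^'+, v (t + h) <= v t + (L + eps) * h.

Lemma dini_le_weaken v t L L' : L <= L' -> dini_le v t L -> dini_le v t L'.
Proof.
move=> LL' vL eps eps0; near=> h.
apply: (@le_trans _ _ (v t + (L + eps) * h)); first by near: h; exact: vL.
have h0 : 0 < h by [].
by rewrite lerD2l ler_pM2r// lerD2r.
Unshelve. all: by end_near. Qed.

Lemma is_derive_right {V : normedModType R} (x : R -> V) t (d : V) :
  is_derive t 1 x d -> h^-1 *: (x (t + h) - x t) @[h --> 0^'+] --> d.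
Proof.
move=> [dx <-].
have right_dnbhs : (0 : R)^'+ `=>` 0^'.
  by move=> A [e e0 eA]; exists e => // h he h0; apply: eA => //; rewrite gt_eqF.
apply: cvg_trans (cvg_trans (cvg_app _ right_dnbhs) dx).
apply: near_eq_cvg; near=> h.
by rewrite /= [_ *: 1]mulr1 [t + h]addrC.
Unshelve. all: by end_near. Qed.

(** Product rule with one differentiable factor; positivity of [e] near [t] allows the one-sided
    bound on [v] to be multiplied by it. *)
Lemma dini_leM v e t L (e' : R) : dini_le v t L -> is_derive t 1 e e' ->
  0 < e t -> dini_le (fun s => v s * e s) t (L * e t + v t * e').
Proof.
move=> vL de et0 eps eps0.
have qe : (e (t + h) - e t) / h @[h --> 0^'+] --> e'.
  have := is_derive_right de; apply: cvg_trans; apply: near_eq_cvg; near=> h.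
  by rewrite mulrC.
(* Chosen so that [d * e t = eps / 2]; the other half of [eps] absorbs the error in the limit. *)
pose d := eps / (2 * e t).
have d0 : 0 < d by rewrite divr_gt0// mulr_gt0.
have e_cvg : e (t + h) @[h --> 0^'+] --> e t.
  have /derivable1_diffP/differentiable_continuous ce : derivable e t 1 by case: de.
  apply: cvg_at_right_filter; rewrite -[X in _ --> e X]addr0.
  apply: continuous_cvg; first by rewrite addr0.
  by apply: cvgD; [exact: cvg_cst|exact: cvg_id].
have lim : v t * ((e (t + h) - e t) / h) + (L + d) * e (t + h)
    @[h --> 0^'+] --> v t * e' + (L + d) * e t.
  by apply: cvgD; apply: cvgMr.
near=> h; have h0 : 0 < h by [].
have eth : 0 < e (t + h) by near: h; exact: (cvgr_gt _ e_cvg).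
apply: (@le_trans _ _ ((v t + (L + d) * h) * e (t + h))).
  by rewrite ler_pM2r//; near: h; exact: vL.
have -> : (v t + (L + d) * h) * e (t + h) = v t * e t +
    (v t * ((e (t + h) - e t) / h) + (L + d) * e (t + h)) * h.
  by field; rewrite gt_eqF.
rewrite lerD2l ler_pM2r//; near: h; apply: (cvgr_le _ lim).
have -> : L * e t + v t * e' + eps = v t * e' + (L + d) * e t + eps / 2.
  by rewrite /d; field; rewrite gt_eqF.
by rewrite ltrDl divr_gt0.
Unshelve. all: by end_near. Qed.

Lemma dini_leDcst v t L (c : R) : dini_le v t L -> dini_le (fun s => v s + c) t L.
Proof.
move=> vL eps eps0; have := vL _ eps0.
by apply: filterS => h vh; rewrite addrAC lerD2r.
Qed.

Lemma exists_between_notin (D : seq R) (a b : R) : a < b ->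
  exists2 y, a < y < b & y \notin D.
Proof.
elim: D a b => [|d D IH] a b ab.
  by exists ((a + b) / 2) => //; rewrite !midf_lt.
have [[ad db]|dab] := pselect (a < d /\ d < b).
  have [y /andP[ay yd] yD] := IH _ _ ad.
  by exists y; rewrite ?ay ?(lt_trans yd db)// inE negb_or yD lt_eqF.
have [y /andP[ay yb] yD] := IH _ _ ab.
exists y; rewrite ?ay// inE negb_or yD andbT.
by apply/eqP => yd; apply: dab; rewrite -yd.
Qed.

(* If v b > v a then some g s = v s - eta (s - a) has g b > g a; the last time c
   at which g takes a well-chosen intermediate value is not in D, and g exceeds
   g c right of c, against the Dini bound. *)
Lemma dini_le0_nonincreasing v (D : seq R) (a b : R) : a < b ->
  {within `[a, b], continuous v} ->
  (forall t, a < t < b -> t \notin D -> dini_le v t 0) -> v b <= v a.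
Proof.
move=> ab /subspace_continuousP vc vD; rewrite leNgt; apply/negP => vab.
(* Half the mean slope of [v], which puts [g b] at the midpoint of [v a] and [v b], still above
   [g a]. *)
pose eta := (v b - v a) / (2 * (b - a)).
have ba0 : 0 < b - a by rewrite subr_gt0.
have eta0 : 0 < eta by rewrite divr_gt0 ?mulr_gt0// subr_gt0.
pose g s := v s - eta * (s - a).
have ga : g a = v a by rewrite /g subrr mulr0 subr0.
have gb : g b = (v a + v b) / 2.
  by rewrite /g /eta; field; rewrite gt_eqF.
have gab : g a < g b by rewrite ga gb; lra.
have gc s : a <= s <= b -> g x @[x --> within `[a, b]%classic (nbhs s)] --> g s.
  move=> sab; apply: cvgB.
    by apply: vc; rewrite /= in_itv.
  apply: cvgMr; apply: cvgB; last exact: cvg_cst.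
  exact: cvg_within.
(* Avoiding the finitely many values of [g] on [D] makes [g c = y] force [c] outside [D]. *)
have [y /andP[ay yb] yD] := exists_between_notin (map g D) gab.
pose E := [set s | a <= s <= b /\ g s <= y].
have Ea : E a by split; [rewrite lexx ltW|exact: ltW].
have Eb : ubound E b by move=> s [/andP[]].
have supE : has_sup E by split; [exists a|exists b].
pose c := sup E.
have ac : a <= c by apply: ub_le_sup => //; exists b.
have cb : c <= b by apply: ge_sup => //; exists a.
have cab : a <= c <= b by rewrite ac.
have gcy : g c <= y.
  rewrite leNgt; apply/negP => ycg.
  have : \forall x \near within `[a, b]%classic (nbhs c), y < g x.
    exact: (cvgr_gt _ (gc _ cab)).
  case=> d /= d0 dP.
  have [s [sab gsy] cs] := sup_adherent d0 supE.
  have sc : s <= c by apply: ub_le_sup => //; exists b.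
  suff : y < g s by rewrite ltNge gsy.
  apply: dP => /=; last by rewrite in_itv.
  by rewrite ger0_norm ?subr_ge0// -/c in cs *; lra.
have cb' : c < b.
  by rewrite lt_neqAle cb andbT; apply: contraTneq gcy => ->; rewrite -ltNge.
have right_gt x : c < x -> x <= b -> y < g x.
  move=> cx xb; rewrite ltNge; apply/negP => gxy.
  suff : x <= c by rewrite leNgt cx.
  apply: ub_le_sup; first by exists b.
  by split => //; rewrite xb andbT (le_trans ac)// ltW.
have right_cvg : g x @[x --> c^'+] --> g c.
  have := gc _ cab; apply: cvg_trans => A [d /= d0 dA].
  exists (Num.min d (b - c)) => /=; first by rewrite lt_min d0 subr_gt0.
  move=> x /=; rewrite lt_min => /andP[xd xb] cx; apply: dA => //=.
  rewrite in_itv/= (le_trans ac (ltW cx))/=.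
  by move: xb; rewrite distrC gtr0_norm ?subr_gt0// => ?; lra.
have gcE : g c = y.
  apply/le_anti; rewrite gcy/=; apply: (cvgr_to_ge right_cvg).
  near=> x; apply: ltW; apply: right_gt => //.
  by near: x; apply: nbhs_right_le.
have ac' : a < c.
  by rewrite lt_neqAle ac andbT; apply: contraTneq ay => ->; rewrite gcE ltxx.
have cD : c \notin D.
  by apply: contra yD => cD; rewrite -gcE map_f.
(* The slack is taken equal to the slope [eta] removed from [v], so the bound reads exactly
   [g (c + h) <= g c]. *)
have dc := vD c (introT andP (conj ac' cb')) cD _ eta0.
near (0 : R)^'+ => h; have h0 : 0 < h by [].
have : y < g (c + h).
  apply: right_gt; first by rewrite ltrDl.
  rewrite -lerBrDl; near: h; apply: nbhs_right_le; by rewrite subr_gt0.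
rewrite -gcE ltNge /g => /negP; apply.
have : v (c + h) <= v c + (0 + eta) * h by near: h; exact: dc.
by move=> ?; lra.
Unshelve. all: by end_near. Qed.

End DiniDerivative.

(** * The differential inequality for the norm of a solution, and convergence to 0 *)

Section Stability.
Context {R : realType} {n : nat} {N : 'cV[R]_n.+1 -> R} (vN : is_vnorm N).

(** First-order expansion: [x (t + h)] is [(1 + h M) x t + h u] plus [h] times an error tending to
    0, and the operator norm of [1 + h M] grows at rate [lognorm N M]. *)
Lemma vnorm_dini_le (x : R -> 'cV[R]_n.+1) (t : R) (M : 'M[R]_n.+1) u :
  is_derive t 1 x (M *m x t + u) ->
  dini_le (fun s => N (x s)) t (lognorm N M * N (x t) + N u).
Proof.
move=> /is_derive_right; set F := M *m x t + u; set q := (fun h => h^-1 *: _) => qF.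
have lim : (opnorm N (1%:M + h *: M) - 1) / h * N (x t) + N u + N (q h - F)
    @[h --> 0^'+] --> lognorm N M * N (x t) + N u + 0.
  apply: cvgD.
    by apply: cvgD; [apply: cvgMl; exact: lognorm_cvg|exact: cvg_cst].
  have qF0 : q h - F @[h --> 0^'+] --> (0 : 'cV[R]_n.+1).
    by rewrite -(subrr F); apply: cvgB => //; exact: cvg_cst.
  by rewrite -[X in _ --> X](vnorm0 vN); apply: (cvg_comp _ _ qF0); exact: vnorm_continuous.
move=> eps eps0; near=> h; have h0 : 0 < h by [].
have -> : x (t + h) = (1%:M + h *: M) *m x t + h *: u + h *: (q h - F).
  rewrite mulmxDl mul1mx -scalemxAl -(addrA (x t)) -scalerDr -/F scalerBr.
  rewrite /q scalerA mulfV ?gt_eqF// scale1r addrACA subrr addr0.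
  by rewrite addrC subrK.
rewrite (le_trans (vnormD vN _ _))// !vnormZ// gtr0_norm//.
rewrite (@le_trans _ _ (opnorm N (1%:M + h *: M) * N (x t) + h * N u + h * N (q h - F)))//.
  rewrite lerD2r (le_trans (vnormD vN _ _))// vnormZ// gtr0_norm// lerD2r.
  exact: opnorm_ub.
have -> : opnorm N (1%:M + h *: M) * N (x t) + h * N u + h * N (q h - F) =
   N (x t) + ((opnorm N (1%:M + h *: M) - 1) / h * N (x t) + N u + N (q h - F)) * h.
  by field; rewrite gt_eqF.
rewrite lerD2l ler_pM2r//; near: h; apply: (cvgr_le _ lim).
by rewrite addr0 ltrDl.
Unshelve. all: by end_near. Qed.

Lemma expR_opp_is_derive (f : R -> R) (t d : R) : is_derive t 1 f d ->
  is_derive t 1 (fun s => expR (- f s)) (- d * expR (- f t)).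
Proof.
move=> fd.
rewrite mulrC; apply: (@is_derive1_comp _ expR (fun s => - f s)).
Qed.

End Stability.

Lemma solution_cvg0 {R : realType} (n : nat) (t0 : R)
    (A Delta K : R -> 'M[R]_n.+1) (B : 'M[R]_n.+1)
    (w : 'cV[R]_n.+1 -> R -> 'cV[R]_n.+1) (N : 'cV[R]_n.+1 -> R)
    (wt : R -> 'cV[R]_n.+1) (T : R) (x : R -> 'cV[R]_n.+1) :
  is_vnorm N ->
  pw_continuous t0 A -> pw_continuous t0 Delta -> pw_continuous t0 K ->
  (\int[lebesgue_measure]_(s in `[t0, +oo[) (`|lognorm N (Delta s)|)%:E < +oo)%E ->
  (forall t, T <= t -> lognorm N (A t + B *m K t) < 0) ->
  (forall y t, t0 <= t -> N (w y t) <= N (wt t)) ->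
  N (wt t) / lognorm N (A t + B *m K t) @[t --> +oo] --> 0 ->
  (\int[lebesgue_measure]_(s in `[t0, t]) (lognorm N (A s + B *m K s))%:E)%E
     @[t --> +oo] --> -oo%E ->
  is_solution t0 (fun y t => (A t + Delta t) *m y + B *m K t *m y + w y t) x ->
  x t @[t --> +oo] --> (0 : 'cV[R]_n.+1).
Proof.
move=> vN pA pD pK intD negL wle wlim intL [xc xd].
pose lam t := lognorm N (A t + B *m K t).
pose del t := `|lognorm N (Delta t)|.
have lam_pw : pw_continuous t0 lam.
  apply: (@pw_continuous_comp _ _ R _ _ (lognorm N)).
    exact: lognorm_continuous.
  by apply: pw_continuousD => //; apply: pw_continuous_comp pK; exact: mulmx_continuous.
have del_pw : pw_continuous t0 del.
  apply: (@pw_continuous_comp _ _ R _ _ (fun M => `|lognorm N M|)) pD.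
  move=> M; apply: (@continuous_comp _ _ _ (lognorm N) (fun r : R => `|r|)).
    exact: lognorm_continuous.
  exact: norm_continuous.
pose m t := \int[lebesgue_measure]_(s in `[t0, t]) lam s.
pose p t := \int[lebesgue_measure]_(s in `[t0, t]) del s.
pose I := fine (\int[lebesgue_measure]_(s in `[t0, +oo[) (del s)%:E)%E.
have p_ge0 t : 0 <= p t by apply: Rintegral_ge0 => s _; exact: normr_ge0.
have p_le t : t0 < t -> p t <= I.
  (* [fine] is monotone only between finite values; [intD] makes the integral over the half-line
     finite. *)
  move=> t0t; apply: fine_le.
  - by apply: integrable_fin_num => //; exact: pw_continuous_integrable.
  - rewrite ge0_fin_numE//; apply: integral_ge0 => s _.
    by rewrite lee_fin normr_ge0.
  - apply: ge0_subset_integral => //.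
    + by apply/measurable_EFinP; exact: pw_continuous_measurable_pinfty.
    + by move=> s _; rewrite lee_fin normr_ge0.
    + by move=> s /=; rewrite !in_itv/= andbT => /andP[].
have m_Ny (r : R) : \forall t \near +oo, m t <= r.
  have t0y : \forall t \near +oo, t0 < t by apply: nbhs_pinfty_gt; rewrite num_real.
  have /cvgeNyPle/(_ r) := intL; apply: filterS2 t0y => t t0t.
  rewrite -lee_fin /m /Rintegral fineK//.
  by apply: integrable_fin_num => //; exact: pw_continuous_integrable.
(* [T1] and [Z] depend on [eps] but the factor [expR I] does not; since [expR (m t)] tends to 0,
   only a multiple of [eps] survives in the limit. *)
have bound eps : 0 < eps -> exists T1 Z, t0 < T1 /\ forall t, T1 < t ->
    N (x t) <= (eps + Z * expR (m t)) * expR I.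
  move=> eps0.
  have [T2 [_ T2P]] : \forall t \near +oo, N (wt t) <= - eps * lam t.
    have wl : \forall t \near +oo, `|0 - N (wt t) / lam t| <= eps.
      by move/cvgrPdist_le : wlim; apply.
    near=> t.
    have lamt : lam t < 0.
      by apply: negL; near: t; apply: nbhs_pinfty_ge; rewrite num_real.
    rewrite -ler_ndivlMr//.
    have : `|0 - N (wt t) / lam t| <= eps.
      by near: t.
    by rewrite sub0r normrN ler_norml => /andP[].
  pose T1 := Num.max (Num.max T2 T) t0 + 1.
  have T21 : T2 < T1 by rewrite ltr_pwDr// !le_max lexx.
  have TT1 : T < T1 by rewrite ltr_pwDr// !le_max lexx orbT.
  have t01 : t0 < T1 by rewrite ltr_pwDr// le_max lexx orbT.
  (* The perturbation bound -eps * lam is what makes -eps the right shift: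
     the right Dini derivative of z is at most
     eps * lam * (1 - exp (-p)) * exp (-m) <= 0. *)
  pose z s := (N (x s) * expR (- p s) + (- eps)) * expR (- m s).
  exists T1, (z T1); split => // t T1t.
  have t0t : t0 < t by exact: lt_trans T1t.
  have z_le : z t <= z T1.
    have [Dx DxP] := xd _ t0t.
    have [Dl [DlP _ _]] := lam_pw _ t0t.
    have [Dd [DdP _ _]] := del_pw _ t0t.
    have sub : `[T1, t] `<=` `[t0, t].
      by apply: subset_itvr; rewrite bnd_simp ltW.
    apply: (@dini_le0_nonincreasing _ z (Dx ++ Dl ++ Dd)) => //.
      have Nx_c : {within `[T1, t], continuous (fun s => N (x s))}.
        apply/subspace_continuousP => s st; apply: cvg_comp; last exact: vnorm_continuous.
        have /subspace_continuousP : {within `[T1, t], continuous x}.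
          apply: continuous_subspaceW xc => u /sub /=.
          by rewrite !in_itv/= => /andP[->].
        exact.
      have m_c : {within `[T1, t], continuous m}.
        by apply: continuous_subspaceW sub _; exact: integral_continuous.
      have p_c : {within `[T1, t], continuous p}.
        by apply: continuous_subspaceW sub _; exact: integral_continuous.
      have exp_c (f : R -> R) : {within `[T1, t], continuous f} ->
          {within `[T1, t], continuous (fun s => expR (- f s))}.
        move=> /subspace_continuousP fc; apply/subspace_continuousP => s st.
        apply: cvg_comp; last exact: continuous_expR.
        by apply: cvgN; exact: fc.
      move/exp_c/subspace_continuousP : m_c => m_c.
      move/exp_c/subspace_continuousP : p_c => p_c.
      move/subspace_continuousP : Nx_c => Nx_c.
      apply/subspace_continuousP => s st; apply: cvgM; last exact: m_c.
      apply: cvgD; last exact: cvg_cst.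
      by apply: cvgM; [exact: Nx_c|exact: p_c].
    move=> s /andP[T1s st]; rewrite !mem_cat !negb_or => /and3P[sDx sDl sDd].
    have t0s : t0 < s by exact: lt_trans T1s.
    have t0st : t0 < s < t by rewrite t0s.
    have dm : is_derive s 1 m (lam s) by apply: integral_is_derive => //; exact: DlP.
    have dp : is_derive s 1 p (del s) by apply: integral_is_derive => //; exact: DdP.
    have lams : lam s < 0 by apply: negL; rewrite ltW// (lt_trans TT1).
    have d1 : dini_le (fun s => N (x s)) s
        ((lam s + del s) * N (x s) - eps * lam s).
      (* The terms are regrouped as [(A + B K) + Delta] so that subadditivity splits off [lam] and
         [del]. *)
      have /(vnorm_dini_le vN) : is_derive s 1 x
          (((A s + B *m K s) + Delta s) *m x s + w (x s) s).
        have := DxP s t0st sDx; congr (is_derive _ _ _ (_ + _)).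
        by rewrite -mulmxDl addrAC.
      apply: dini_le_weaken; apply: lerD.
        rewrite ler_wpM2r ?vnorm_ge0// (le_trans (lognormD vN _ _))// lerD2l.
        exact: ler_norm.
      by rewrite (le_trans (wle _ _ (ltW t0s)))// -mulNr T2P// (lt_trans T21).
    have d2 := dini_leM d1 (expR_opp_is_derive dp) (expR_gt0 _).
    have d3 := dini_leM (dini_leDcst (- eps) d2) (expR_opp_is_derive dm) (expR_gt0 _).
    apply: dini_le_weaken d3.
    (* The factor [expR (- p s)] cancels the [del s] term, and [expR (- m s)] cancels the term in
       [lam s * N (x s)]. *)
    rewrite (_ : _ + _ = eps * lam s * (1 - expR (- p s)) * expR (- m s)); last by ring.
    rewrite pmulr_lle0 ?expR_gt0// mulr_le0_ge0//.
      by rewrite pmulr_rle0// ltW.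
    by rewrite subr_ge0 -expR0 ler_expR lerNl oppr0.
  have : N (x t) * expR (- p t) <= eps + z T1 * expR (m t).
    rewrite -lerBlDl -ler_pdivrMr ?expR_gt0// -expRN.
    exact: z_le.
  rewrite expRN ler_pdivrMr ?expR_gt0// => Nxt.
  (* Nonnegativity is needed to enlarge the factor [expR (p t)] to [expR I], as [z T1] may be
     negative. *)
  have e0 : 0 <= eps + z T1 * expR (m t).
    by rewrite -(pmulr_lge0 _ (expR_gt0 (p t))) (le_trans _ Nxt)// vnorm_ge0.
  by rewrite (le_trans Nxt)// ler_wpM2l// ler_expR p_le.
have [C C0 xC] := norm_le_vnorm vN.
apply/cvgr0Pnorm_le => /= e e0.
(* With this choice [eps] and [Z * expR (m t)] each contribute at most [e / 2] to the maximum norm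
   of [x t]. *)
pose eps := e / (2 * C * expR I).
have eps0 : 0 < eps by rewrite divr_gt0// !mulr_gt0// expR_gt0.
have [T1 [Z [t01 NxP]]] := bound _ eps0.
have Z1 : 0 < `|Z| + 1 by rewrite ltr_wpDl.
near=> t.
have T1t : T1 < t by near: t; apply: nbhs_pinfty_gt; rewrite num_real.
have Zm : Z * expR (m t) <= eps.
  have mt : expR (m t) <= eps / (`|Z| + 1).
    have q0 : 0 < eps / (`|Z| + 1) by exact: divr_gt0.
    rewrite -[leRHS](lnK (q0 : _ \in Num.pos)) ler_expR; near: t; exact: m_Ny.
  rewrite (@le_trans _ _ ((`|Z| + 1) * expR (m t)))//.
    by rewrite ler_wpM2r ?expR_ge0// (le_trans (ler_norm Z))// lerDl.
  by rewrite mulrC -ler_pdivlMr.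
rewrite (le_trans (xC _))// mulrC -ler_pdivlMr// (le_trans (NxP _ T1t))//.
rewrite (@le_trans _ _ ((eps + eps) * expR I))//.
  by rewrite ler_wpM2r ?expR_ge0// lerD2l.
rewrite le_eqVlt; apply/orP; left; apply/eqP; rewrite /eps; field.
by rewrite !gt_eqF// expR_gt0.
Unshelve. all: by end_near. Qed.

Unset Implicit Arguments.

Theorem theorem5 (R : realType) (n : nat) (t0 : R)
    (A Delta K : R -> 'M[R]_n) (B : 'M[R]_n) (w : 'cV[R]_n -> R -> 'cV[R]_n)
    (N : 'cV[R]_n -> R) :
  pw_continuous t0 A -> pw_continuous t0 Delta -> pw_continuous t0 K ->
  pw_continuous2 t0 w ->
  is_vnorm N ->
  (* (A1) *)
  (\int[lebesgue_measure]_(s in `[t0, +oo[) (`|lognorm N (Delta s)|)%:E < +oo)%E ->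
  (* (A2) *)
  (exists T, t0 <= T /\ forall t, T <= t -> lognorm N (A t + B *m K t) < 0) ->
  (* (A3) *)
  (exists wt : R -> 'cV[R]_n,
     [/\ pw_continuous t0 wt,
         (forall x t, t0 <= t -> N (w x t) <= N (wt t)) &
         N (wt t) / lognorm N (A t + B *m K t) @[t --> +oo] --> 0]) ->
  (* (A4) *)
  (\int[lebesgue_measure]_(s in `[t0, t]) (lognorm N (A s + B *m K s))%:E)%E
     @[t --> +oo] --> -oo%E ->
  forall x : R -> 'cV[R]_n,
    is_solution t0 (fun y t => (A t + Delta t) *m y + B *m K t *m y + w y t) x ->
    x t @[t --> +oo] --> (0 : 'cV[R]_n).
Proof.
move=> pA pD pK _ vN intD [T [_ negL]] [wt [_ wle wlim]] intL x sol.
(* In dimension 0 the only vector is 0, so the solution is constantly 0; the logarithmic norm is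
   controlled only in positive dimension. *)
case: n A Delta K B w N pA pD pK vN intD negL wt wle wlim intL x sol =>
    [|n'] A Delta K B w N pA pD pK vN intD negL wt wle wlim intL x sol.
  have -> : x = fun=> 0 by apply/funext => t; exact: flatmx0.
  exact: cvg_cst.
exact: solution_cvg0 vN pA pD pK intD negL wle wlim intL sol.
Qed.
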